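(* Let $V=V_\bullet=(V_n)_{n}$ be a sequence where each $V_n$ is a finite-dimensional $\mathbb{C}[S_n]$-module. Then $V$ is URMS if $\mathrm{wt}(V)<\infty$ and the sequence of Frobenius images $(\mathcal{F}(V_n))_n$ is $m$-stable. In this case, for each partition $\lambda$, the multiplicity of $\mathbb{S}^{\lambda[n]}$ in $V_n$ stabilizes (is constant in $n$) once $$n\ge\max_{|\mu|\le|\lambda|}\mathrm{rg}^m_\mu(\mathcal{F}(V_\bullet)),$$ and a URMS stable range of $V_\bullet$ is given by $$n\ge\max_{|\mu|\le\mathrm{wt}(V)}\mathrm{rg}^m_\mu(\mathcal{F}(V_\bullet)).$$
   Context: For a partition $\lambda=(\lambda_1,\dots,\lambda_l)$ and $n$ with $n-|\lambda|\ge\lambda_1$ (with $\lambda_1=0$ if $\lambda=\emptyset$), $\lambda[n]:=(n-|\lambda|,\lambda_1,\dots,\lambda_l)\vdash n$; otherwise $\lambda[n]$ is undefined. $\mathbb{S}^\nu$ is the Specht module indexed by $\nu\vdash n$. Write $V_n\cong\bigoplus_\lambda(\mathbb{S}^{\lambda[n]})^{\oplus c_{\lambda,n}}$, with $c_{\lambda,n}=0$ when $\lambda[n]$ is undefined. $V_\bullet$ is URMS (uniformly representation multiplicity stable) if there is $N$ such that $c_{\lambda,n}=c_{\lambda,n+1}$ for all $n\ge N$ and all $\lambda$; such an $N$ is a URMS stable range, and ''a URMS stable range is given by $n\ge N$'' means that this $N$ is one. $\mathrm{wt}(V)=\sup\{|\lambda| : c_{\lambda,n}\ne0\text{ for some }n\ge|\lambda|+\lambda_1\}$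 (supremum of the empty set being $0$). $\mathcal{F}$ is the linear map with $\mathcal{F}(\mathbb{S}^\nu)=s_\nu$. For homogeneous symmetric functions $F_n$ of degree $n$ write $F_n=\sum_\mu d_{\mu,n}m_{\mu[n]}$ (monomial basis, $d_{\mu,n}=0$ if $\mu[n]$ is undefined). $\mathrm{rg}^m_\mu(F_\bullet)$ is the smallest $n$ with $d_{\mu,n}=d_{\mu,n+k}$ for all $k\ge0$ ($\infty$ if none); $F_\bullet$ is $m$-stable if all $\mathrm{rg}^m_\mu(F_\bullet)$ are finite. *)

(* Defs.v *)
From HB Require Import structures.
From mathcomp Require Import all_boot all_order all_algebra all_fingroup.
From mathcomp Require Import mxrepresentation character.
From mathcomp Require Import finmap complex.
From mathcomp Require Import all_classical all_reals all_analysis.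

Set Implicit Arguments.
Unset Strict Implicit.
Unset Printing Implicit Defensive.

Import Order.TTheory GRing.Theory Num.Theory.

Local Open Scope classical_set_scope.
Local Open Scope ring_scope.

(** * Partitions *)

(* Partitions are weakly decreasing sequences of positive integers, so that
   Leibniz equality of sequences is equality of partitions; [sumn s] is |s| and
   [head 0 s] is the largest part (0 for the empty partition). *)
Definition is_part (s : seq nat) : bool := sorted geq s && (0%N \notin s).

(* A partition of n has at most n parts, each of them at most n. *)
Definition parts (n : nat) : seq (seq nat) :=
  [seq nu <- [seq map val (val s) | s : n.-bseq 'I_n.+1]
  | is_part nu & sumn nu == n].

(* lambda[n] is defined iff n - |lambda| >= lambda_1. *)
Definition pad_def (lam : seq nat) (n : nat) : bool :=
  (sumn lam + head 0 lam <= n)%N.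

(* The first part is dropped when it is 0, which for a defined lambda[n]
   happens only for lambda empty and n = 0. *)
Definition pad (lam : seq nat) (n : nat) : seq nat :=
  [seq i <- (n - sumn lam)%N :: lam | (0 < i)%N].

(** * Specht modules *)

(* The cells of the Young diagram of nu are numbered 0, ..., |nu|-1 row by row;
   these numbers also form the tableau from which the Specht module is built.
   Row lengths and column numbers are as in [reshape]. *)
Definition cell_row (nu : seq nat) (i : nat) : nat := reshape_index nu i.
Definition cell_col (nu : seq nat) (i : nat) : nat := reshape_offset nu i.

Section Specht.
Variables (F : fieldType) (n : nat).
Implicit Type nu : seq nat.

Definition row_stab nu : {set 'S_n} :=
  [set p : 'S_n | [forall i : 'I_n, cell_row nu (p i) == cell_row nu i]]%SET.

Definition col_stab nu : {set 'S_n} :=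
  [set p : 'S_n | [forall i : 'I_n, cell_col nu (p i) == cell_col nu i]]%SET.

(* F[S_n] is the row space underlying [regular_repr], in which a permutation g
   is the basis vector of index [gring_index _ g]. *)
Definition young_symmetrizer nu : 'rV[F]_#|[set: 'S_n]%G| :=
  \sum_(p in row_stab nu) \sum_(q in col_stab nu)
    (-1) ^+ q *: delta_mx 0 (gring_index [set: 'S_n]%G (p * q)%g).

(* The submodule of the regular representation generated by the Young
   symmetrizer; modules are right modules here. *)
Definition specht nu : representation F [set: 'S_n]%G :=
  Representation
    (submod_repr (cyclic_mx_module (regular_repr F [set: 'S_n]%G)
                                   (young_symmetrizer nu))).

(* (+)_(nu |- n) (S^nu)^(+ c nu) *)
Definition specht_sum (c : seq nat -> nat) : representation F [set: 'S_n]%G :=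
  \big[dadd_grepr/grepr0]_(nu <- parts n) muln_grepr (specht nu) (c nu).

(* The multiplicities in a decomposition of W into Specht modules.  In
   characteristic 0 such a decomposition exists and its multiplicities are
   unique on the partitions of n, the only arguments at which [mult] is used. *)
Definition mult (W : representation F [set: 'S_n]%G) : seq nat -> nat :=
  xget (fun=> 0%N) [set c | mx_rsim W (specht_sum c)].

End Specht.

(** * Symmetric functions *)

(* A monomial in x_0, x_1, ... is given by its finitely supported exponent;
   symmetric functions are formal power series in these infinitely many
   variables, i.e. coefficient functions on monomials. *)
Definition expo : Type := {fsfun nat -> nat with 0%N}.
Definition series (K : Type) : Type := expo -> K.

(* Semistandard fillings of nu of content a; their entries lie in the support
   of a. *)
Definition ssyt (nu : seq nat) (a : expo) :
    {set {ffun 'I_(sumn nu) -> finsupp a}} :=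
  [set T : {ffun 'I_(sumn nu) -> finsupp a} |
     [&& [forall i : 'I_(sumn nu), forall j : 'I_(sumn nu),
            (cell_row nu i == cell_row nu j) &&
            (cell_col nu i <= cell_col nu j)%N ==> (val (T i) <= val (T j))%N],
         [forall i : 'I_(sumn nu), forall j : 'I_(sumn nu),
            (cell_col nu i == cell_col nu j) &&
            (cell_row nu i < cell_row nu j)%N ==> (val (T i) < val (T j))%N]
       & [forall k : finsupp a, #|[set i | T i == k]%SET| == a (val k)]]]%SET.

(* s_nu = sum over semistandard tableaux T of shape nu of x^T *)
Definition schur (K : nzRingType) (nu : seq nat) : series K :=
  fun a => #|ssyt nu a|%:R.

(* m_nu is the sum of all monomials whose nonzero exponents, sorted, are nu. *)
Definition expo_type (a : expo) : seq nat :=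
  sort geq [seq a k | k <- enum_fset (finsupp a)].

Definition msym (K : nzRingType) (nu : seq nat) : series K :=
  fun a => (expo_type a == nu)%:R.

(* The monomial x_0^nu_0 x_1^nu_1 ... *)
Definition part_expo (nu : seq nat) : expo :=
  [fsfun k in seq_fset tt (iota 0 (size nu)) => nth 0%N nu k].

(* The coefficient of m_nu in a symmetric function: m_nu is the only monomial
   symmetric function in which the monomial [part_expo nu] occurs; see
   [mcoefP]. *)
Definition mcoef (K : nzRingType) (f : series K) (nu : seq nat) : K :=
  f (part_expo nu).

Lemma part_expoE nu k : part_expo nu k = nth 0%N nu k.
Proof.
rewrite fsfunE seq_fsetE mem_iota /= add0n; case: ltnP => // le_nu_k.
by rewrite nth_default.
Qed.

Lemma expo_type_part nu : is_part nu -> expo_type (part_expo nu) = nu.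
Proof.
case/andP=> nu_sorted nu_pos.
have geqT : transitive geq by move=> x y z /= xy /leq_trans; exact.
have geqA : antisymmetric geq by move=> x y /= /andP[a b]; apply/eqP; rewrite eqn_leq a b.
have geq_tot : total geq by move=> x y /=; exact: leq_total.
rewrite /expo_type; apply: (sorted_eq geqT geqA) => //.
  exact: sort_sorted.
rewrite perm_sort -[X in perm_eq _ X](mkseq_nth 0%N nu) /mkseq.
rewrite (eq_map (part_expoE nu)); apply: perm_map.
apply: uniq_perm; rewrite ?fset_uniq ?iota_uniq // => k.
rewrite mem_iota /= add0n mem_finsupp part_expoE.
case: ltnP => [lt_k|le_k]; last by rewrite nth_default ?eqxx.
by apply: contra nu_pos => /eqP <-; rewrite mem_nth.
Qed.

Lemma parts_uniq n : uniq (parts n).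
Proof.
apply: filter_uniq; rewrite map_inj_uniq ?enum_uniq // => s t /=.
by move/(inj_map val_inj)/val_inj.
Qed.

Lemma parts_is_part n nu : nu \in parts n -> is_part nu.
Proof. by rewrite mem_filter => /andP[/andP[]]. Qed.

Lemma mem_parts n nu : (nu \in parts n) = is_part nu && (sumn nu == n).
Proof.
rewrite mem_filter; case: (boolP (is_part nu && _)) => //= /andP[nu_part /eqP nun].
have size_le : (size nu <= n)%N.
  have: 0%N \notin nu by case/andP: nu_part.
  rewrite -nun {nun nu_part}; elim: nu => //= x s IHs.
  rewrite inE negb_or eq_sym -lt0n => /andP[x0 /IHs].
  by rewrite -add1n; apply: leq_add.
have le_n x : x \in nu -> (x < n.+1)%N.
  by move=> xnu; rewrite ltnS -nun sumnE (big_rem x xnu) leq_addr.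
pose s := [seq inord x : 'I_n.+1 | x <- nu].
have size_s : (size s <= n)%N by rewrite size_map.
apply/mapP; exists (Bseq size_s); first by rewrite mem_enum.
rewrite /= -map_comp -[LHS]map_id; apply/eq_in_map => x xnu.
by rewrite /= inordK ?le_n.
Qed.

Lemma mcoefP (K : nzRingType) n (d : seq nat -> K) (f : series K) :
    (forall a, f a = \sum_(nu <- parts n) d nu * msym K nu a) ->
  {in parts n, forall nu, mcoef f nu = d nu}.
Proof.
move=> fE nu nu_n; rewrite /mcoef fE (bigD1_seq nu) ?parts_uniq //= big1.
  by rewrite addr0 /msym expo_type_part ?(parts_is_part nu_n)// eqxx mulr1.
move=> ka ka_nu; rewrite /msym expo_type_part ?(parts_is_part nu_n)//.
by rewrite eq_sym (negPf ka_nu) mulr0.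
Qed.

(* The linear map sending (the class of) S^nu to s_nu. *)
Definition frobenius (F : fieldType) n (W : representation F [set: 'S_n]%G) :
    series F :=
  fun a => \sum_(nu <- parts n) (mult W nu)%:R * schur F nu a.

(** * Stability *)

(* d_(mu, n) *)
Definition dcoef (K : nzRingType) (F : nat -> series K) (mu : seq nat)
    (n : nat) : K :=
  if pad_def mu n then mcoef (F n) (pad mu n) else 0.

Section Stability.
Variable R : realType.

(* Least element of a set of naturals, +oo if the set is empty. *)
Definition rgm (K : nzRingType) (F : nat -> series K) (mu : seq nat) : \bar R :=
  ereal_inf [set n%:R%:E | n in
               [set n | forall k, dcoef F mu n = dcoef F mu (n + k)]].

Definition m_stable (K : nzRingType) (F : nat -> series K) : Prop :=
  forall mu, is_part mu -> (rgm F mu < +oo)%E.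

(* max_(|mu| <= b) rg_mu(F); for b finite and nonnegative this is a supremum
   over a nonempty finite set. *)
Definition rgm_max (K : nzRingType) (F : nat -> series K) (b : \bar R) :
    \bar R :=
  ereal_sup [set rgm F mu | mu in
               [set mu | is_part mu /\ ((sumn mu)%:R%:E <= b)%E]].

Variable V : forall n, representation R[i] [set: 'S_n]%G.

(* c_(lambda, n) *)
Definition cmult (lam : seq nat) (n : nat) : nat :=
  if pad_def lam n then mult (V n) (pad lam n) else 0%N.

Definition URMS_range (N : nat) : Prop :=
  forall n lam, (N <= n)%N -> is_part lam -> cmult lam n = cmult lam n.+1.

Definition URMS : Prop := exists N, URMS_range N.

(* Adjoining 0 makes the supremum of the empty set 0. *)
Definition wt : \bar R :=
  ereal_sup (0%E |` [set (sumn lam)%:R%:E | lam in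
    [set lam | is_part lam /\
       exists n, (sumn lam + head 0 lam <= n)%N /\ cmult lam n <> 0%N]]).

Definition frobenius_seq : nat -> series R[i] := fun n => frobenius (V n).

End Stability.

(* Main.v *)
Require Import Defs.
From mathcomp Require Import all_boot all_order all_algebra all_fingroup.
From mathcomp Require Import mxrepresentation character.
From mathcomp Require Import finmap complex.
From mathcomp Require Import all_classical all_reals all_analysis.
From mathcomp Require Import zify.

(** The multiplicities [c_(lambda,n)] and the monomial coefficients
    [d_(mu,n)] of the Frobenius image are related by Kostka numbers:

      d_(mu,n) = sum over lambda of c_(lambda,n) * K_(lambda[n],mu[n]).

    A semistandard filling of shape [lambda[n]] and content [mu[n]] has its
    smallest entries in the first row, and every entry is at least the number
    of its row; hence [K_(lambda[n],mu[n])] vanishes unless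
    [|lambda| <= |mu|], and the system is unitriangular once partitions are
    ordered by the sum of the row numbers of the cells of [lambda[n]], a
    quantity that does not depend on [n] ([kostka_pad_gt0]).  So one wants to
    solve for the [c_(lambda,n)] by induction along this order; the argument
    works for arbitrary natural numbers in place of multiplicities.

    The obstacle is that [K_(lambda[n],mu[n])] is in general independent of [n]
    only from [|mu| + lambda_1] on, when the smallest entries cover the second
    row ([kostka_pad_stable]); this may exceed the least [n] at which both
    [lambda[n]] and [mu[n]] are defined.  The way out
    is positivity.  Let all [d_(mu,n)] with [|mu| <= m] be constant from [n0]
    on, and let [c_(lambda,n)] be nonzero for all [n >= n0], with
    [0 < |lambda| <= m].  Enlarging the first part of [lambda] gives a
    partition [mu] of [m] for which [K_(lambda[n],mu[n])] is positive whenever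
    [mu[n]] is defined ([kostka_pad_spread]).  Then [d_(mu,n)] is nonzero for
    large [n], so also at [n0]; hence [mu[n0]] is defined, that is,
    [n0 >= |mu| + mu_1 >= m + lambda_1] ([persistent_bound]).  The Kostka
    numbers that multiply a persistently nonzero [c_(lambda,n)] are therefore
    constant from [n0] on, and the induction goes through
    ([padded_mult_stable]).  If [lambda[n0]] is undefined, then [d_(lambda,n)]
    is zero from [n0] on and bounds [c_(lambda,n)] from above.

    The statement about the weight follows because [c_(lambda,n)] is zero
    when [|lambda|] exceeds it. *)

Import Order.TTheory GRing.Theory Num.Theory.

Local Open Scope classical_set_scope.
Local Open Scope ring_scope.

(** * Semistandard tableaux as words *)

Section ReadingWords.
Local Open Scope nat_scope.
Implicit Types (nu : seq nat) (a : expo) (s : seq nat).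

(** Tableaux are handled as words of natural numbers, listing the entries row
    by row: unlike finite functions from the cells to the support of the
    content, words of different shapes and contents live in one type, so that
    adding a cell is just [cons]. *)
Definition is_tableau nu a s : Prop :=
  [/\ size s = sumn nu,
      forall i j, i < sumn nu -> j < sumn nu ->
        cell_row nu i = cell_row nu j -> cell_col nu i <= cell_col nu j ->
        nth 0 s i <= nth 0 s j,
      forall i j, i < sumn nu -> j < sumn nu ->
        cell_col nu i = cell_col nu j -> cell_row nu i < cell_row nu j ->
        nth 0 s i < nth 0 s j
    & forall k, count_mem k s = a k].

Definition reading_word nu a (T : {ffun 'I_(sumn nu) -> finsupp a}) : seq nat :=
  [seq val (T i) | i <- enum 'I_(sumn nu)].

Definition tableau_words nu a : seq (seq nat) :=
  [seq reading_word nu a T | T <- enum (ssyt nu a)].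

Lemma nth_reading_word nu a T (i : 'I_(sumn nu)) :
  nth 0 (reading_word nu a T) i = val (T i).
Proof. by rewrite (nth_map i) ?size_enum_ord // nth_ord_enum. Qed.

Lemma reading_word_inj nu a : injective (reading_word nu a).
Proof.
move=> T U eTU; apply/ffunP=> i; apply: val_inj.
by rewrite -!nth_reading_word eTU.
Qed.

Lemma tableau_words_uniq nu a : uniq (tableau_words nu a).
Proof. by rewrite map_inj_uniq ?enum_uniq //; apply: reading_word_inj. Qed.

Lemma size_tableau_words nu a : size (tableau_words nu a) = #|ssyt nu a|.
Proof. by rewrite size_map -cardE. Qed.

Lemma mem_tableau_words nu a s : s \in tableau_words nu a <-> is_tableau nu a s.
Proof.
split.
  case/mapP=> T; rewrite mem_enum inE => /and3P[rowT colT cntT] ->.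
  have nthT i (lt_i : i < sumn nu) :
      nth 0 (reading_word nu a T) i = val (T (Ordinal lt_i)).
    exact: (nth_reading_word nu a T (Ordinal lt_i)).
  split.
  - by rewrite size_map size_enum_ord.
  - move=> i j lt_i lt_j eq_r le_c; rewrite !nthT.
    have /forallP/(_ (Ordinal lt_j))/implyP-> // := forallP rowT (Ordinal lt_i).
    by rewrite /= eq_r eqxx.
  - move=> i j lt_i lt_j eq_c lt_r; rewrite !nthT.
    have /forallP/(_ (Ordinal lt_j))/implyP-> // := forallP colT (Ordinal lt_i).
    by rewrite /= eq_c eqxx.
  - move=> k; have [a_k|a'k] := boolP (k \in finsupp a); last first.
      rewrite (fsfun_dflt a'k); apply/count_memPn.
      by apply: contra a'k => /mapP[i _ ->]; apply: valP.
    have /eqP <- := forallP cntT [` a_k]%fset.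
    rewrite count_map cardE size_filter.
    rewrite -enumT; apply: eq_count => i.
    rewrite -[RHS]/(i \in [set i0 | T i0 == [` a_k]%fset]%SET) [RHS]inE /=.
    by apply/eqP/eqP=> [eTk|->] //; apply: val_inj.
case=> sz_s row_s col_s cnt_s.
have s_a (i : 'I_(sumn nu)) : nth 0 s i \in finsupp a.
  rewrite mem_finsupp -cnt_s -lt0n -has_count has_pred1.
  by rewrite mem_nth // sz_s.
pose T := [ffun i => [` s_a i]%fset].
have sE : s = reading_word nu a T.
  apply: (@eq_from_nth _ 0); first by rewrite size_map size_enum_ord.
  move=> i; rewrite sz_s => lt_i.
  by rewrite (nth_reading_word nu a T (Ordinal lt_i)) ffunE.
apply/mapP; exists T => //; rewrite mem_enum inE; apply/and3P; split.
- apply/forallP=> i; apply/forallP=> j; apply/implyP=> /andP[/eqP eq_r le_c].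
  by rewrite !ffunE /= row_s.
- apply/forallP=> i; apply/forallP=> j; apply/implyP=> /andP[/eqP eq_c lt_r].
  by rewrite !ffunE /= col_s.
- apply/forallP=> k; rewrite -cnt_s sE count_map cardE size_filter -enumT.
  apply/eqP/eq_count=> i.
  rewrite -[LHS]/(i \in [set i0 | T i0 == k]%SET) [LHS]inE /=.
  by apply/eqP/eqP=> [->|eTk] //; apply: val_inj.
Qed.

End ReadingWords.

(** * Kostka numbers *)

Section Kostka.
Local Open Scope nat_scope.
Implicit Types (nu mu lam : seq nat) (a : expo) (s : seq nat).

Lemma cell_row_cons x lam i :
  cell_row (x :: lam) i = if i < x then 0 else (cell_row lam (i - x)).+1.
Proof.
rewrite /cell_row /reshape_index /= subn_eq0.
by case: ltnP => // le_x_i; rewrite subSn.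
Qed.

Lemma cell_col_cons x lam i :
  cell_col (x :: lam) i = if i < x then i else cell_col lam (i - x).
Proof.
rewrite /cell_col /reshape_offset -/(cell_row _ _) cell_row_cons.
by case: ltnP => _ /=; rewrite ?subn0 // subnDA.
Qed.

Lemma cell_row0 x lam i : (cell_row (x :: lam) i == 0) = (i < x).
Proof. by rewrite cell_row_cons; case: ltnP. Qed.

Lemma cell_row_lt nu i : i < sumn nu -> cell_row nu i < size nu.
Proof. exact: reshape_indexP. Qed.

Lemma cell_col_lt nu i : i < sumn nu -> cell_col nu i < nth 0 nu (cell_row nu i).
Proof. exact: reshape_offsetP. Qed.

Lemma cell_above nu i r :
    sorted geq nu -> i < sumn nu -> r <= cell_row nu i ->
  exists k, [/\ k < sumn nu, cell_row nu k = r & cell_col nu k = cell_col nu i].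
Proof.
move=> nu_sorted lt_i le_r.
have lt_c : cell_col nu i < nth 0 nu r.
  apply: leq_trans (cell_col_lt nu i lt_i) _.
  have geqT : transitive geq by move=> x y z /= xy /leq_trans; exact.
  have lt_row := cell_row_lt nu i lt_i.
  have := sorted_leq_nth geqT leqnn 0 nu_sorted r (cell_row nu i).
  by apply; rewrite ?inE //; apply: leq_ltn_trans le_r lt_row.
exists (flatten_index nu r (cell_col nu i)).
by rewrite flatten_indexP // /cell_row flatten_indexKl // {1}/cell_col flatten_indexKr.
Qed.

(** The superstandard tableau: the smallest tableau of shape [nu], and the only
    one of content [nu].  The sum of its entries is the statistic that orders
    partitions below. *)
Definition row_word nu : seq nat := [seq cell_row nu i | i <- iota 0 (sumn nu)].

Definition row_weight nu := sumn (row_word nu).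

Lemma size_row_word nu : size (row_word nu) = sumn nu.
Proof. by rewrite size_map size_iota. Qed.

Lemma nth_row_word nu i : i < sumn nu -> nth 0 (row_word nu) i = cell_row nu i.
Proof. by move=> lt_i; rewrite (nth_map 0) ?size_iota // nth_iota. Qed.

Lemma row_word_cons x lam :
  row_word (x :: lam) = nseq x 0 ++ [seq r.+1 | r <- row_word lam].
Proof.
apply: (@eq_from_nth _ 0).
  by rewrite size_cat size_nseq size_map !size_row_word.
move=> i; rewrite size_row_word => lt_i.
rewrite nth_row_word // cell_row_cons nth_cat size_nseq nth_nseq.
case: ltnP => // le_x_i; have lt_ix : i - x < sumn lam by move: lt_i => /=; lia.
by rewrite (nth_map 0) ?size_row_word // nth_row_word.
Qed.

Lemma count_map_succ k s :
  count_mem k [seq r.+1 | r <- s] = if k is k'.+1 then count_mem k' s else 0.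
Proof.
rewrite count_map; case: k => [|k]; last by apply: eq_count => r /=; rewrite eqSS.
by apply/eqP; rewrite -leqn0 leqNgt -has_count; apply/hasPn.
Qed.

Lemma count_row_word nu k : count_mem k (row_word nu) = nth 0 nu k.
Proof.
elim: nu k => [|x lam IHlam] k; first by rewrite nth_nil.
rewrite row_word_cons count_cat count_nseq count_map_succ.
by case: k => [|k] /=; rewrite ?mul1n ?addn0 ?mul0n // IHlam.
Qed.

Lemma row_weight_cons x lam : row_weight (x :: lam) = row_weight lam + sumn lam.
Proof.
rewrite /row_weight row_word_cons sumn_cat sumn_nseq mul0n add0n.
rewrite -[sumn lam]size_row_word.
by elim: (row_word lam) => //= r s ->; lia.
Qed.

Lemma is_tableau_row_word nu : is_tableau nu (part_expo nu) (row_word nu).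
Proof.
split=> [|i j lt_i lt_j eq_r _|i j lt_i lt_j _ lt_r|k].
- exact: size_row_word.
- by rewrite !nth_row_word // eq_r.
- by rewrite !nth_row_word.
- by rewrite count_row_word part_expoE.
Qed.

(** Entries start at 0 and increase strictly down each column. *)
Lemma tableau_row_le nu a s i : sorted geq nu -> is_tableau nu a s ->
  i < sumn nu -> cell_row nu i <= nth 0 s i.
Proof.
move=> nu_sorted [_ _ col_s _]; move eq_r: (cell_row nu i) => r.
elim: r i eq_r => // r IHr i eq_r lt_i.
have [|k [lt_k row_k col_k]] := cell_above nu i r nu_sorted lt_i.
  by rewrite eq_r.
by apply: leq_ltn_trans (IHr k row_k lt_k) _; apply: col_s; rewrite ?row_k ?eq_r.
Qed.

Lemma all2_leq_sumn s t : all2 leq s t -> sumn s <= sumn t ?= iff (s == t).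
Proof.
elim: s t => [|x s IHs] [|y t] //= /andP[le_xy /IHs le_st].
by rewrite eqseq_cons; apply: leqif_add => //; split.
Qed.

Lemma all2_leq_count0 s t : all2 leq s t -> count_mem 0 t <= count_mem 0 s.
Proof.
elim: s t => [|x s IHs] [|y t] //= /andP[le_xy /IHs le_st].
by apply: leq_add => //; lia.
Qed.

Lemma tableau_row_word_le nu a s :
  sorted geq nu -> is_tableau nu a s -> all2 leq (row_word nu) s.
Proof.
move=> nu_sorted tab_s; have [sz_s _ _ _] := tab_s.
rewrite all2E size_row_word sz_s eqxx /=; apply/(all_nthP (0, 0)) => i.
rewrite size_zip size_row_word sz_s minnn => lt_i.
rewrite nth_zip ?size_row_word //= nth_row_word //.
exact: tableau_row_le tab_s lt_i.
Qed.

Definition kostka nu mu := #|ssyt nu (part_expo mu)|.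

Lemma kostka_gt0P nu mu :
  reflect (exists s, is_tableau nu (part_expo mu) s) (0 < kostka nu mu).
Proof.
rewrite /kostka -size_tableau_words -has_predT.
apply: (iffP hasP) => [[s /mem_tableau_words tab_s _]|[s tab_s]]; exists s => //.
exact/mem_tableau_words.
Qed.

(** The sum of the entries depends on the content alone, and [row_word mu] is
    one word of content [mu]. *)
Lemma tableau_sumn nu mu s :
  is_tableau nu (part_expo mu) s -> sumn s = row_weight mu.
Proof.
case=> _ _ _ cnt_s; apply: perm_sumn; rewrite /perm_eq; apply/allP=> k _ /=.
by rewrite cnt_s part_expoE count_row_word.
Qed.

Lemma is_part_inj nu mu : is_part nu -> is_part mu ->
  (forall k, nth 0 nu k = nth 0 mu k) -> nu = mu.
Proof.
have size_le s t : 0 \notin s -> (forall k, nth 0 s k = nth 0 t k) ->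
    size s <= size t.
  move=> s_pos eq_st; rewrite leqNgt; apply: contra s_pos => lt_ts.
  by rewrite -(nth_default 0 (leqnn (size t))) -eq_st mem_nth.
move=> /andP[_ nu_pos] /andP[_ mu_pos] eq_nm.
apply: (@eq_from_nth _ 0) => [|i _]; last exact: eq_nm.
by apply/eqP; rewrite eqn_leq !size_le.
Qed.

(** Unitriangularity.  A tableau dominates the superstandard one of its shape
    entrywise, so the sums of their entries compare; if these agree, the two
    tableaux coincide and the content is the shape. *)
Lemma kostka_weight nu mu : is_part nu -> is_part mu -> 0 < kostka nu mu ->
  nu = mu \/ row_weight nu < row_weight mu.
Proof.
move=> nu_part mu_part /kostka_gt0P[s tab_s].
have nu_sorted : sorted geq nu by case/andP: nu_part.
have [] := all2_leq_sumn _ _ (tableau_row_word_le _ _ _ nu_sorted tab_s).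
rewrite (tableau_sumn _ _ _ tab_s) -/(row_weight nu) leq_eqVlt.
case: eqP => [_ _|_ /= lt_w _]; last by right.
move/esym/eqP=> eq_s; left; apply: is_part_inj => // k.
case: tab_s => _ _ _ /(_ k); rewrite part_expoE -eq_s.
by rewrite count_row_word.
Qed.

(** All entries 0 of a tableau lie in its first row. *)
Lemma kostka_head nu mu :
  sorted geq nu -> 0 < kostka nu mu -> head 0 mu <= head 0 nu.
Proof.
move=> nu_sorted /kostka_gt0P[s tab_s].
have := all2_leq_count0 _ _ (tableau_row_word_le _ _ _ nu_sorted tab_s).
by case: tab_s => _ _ _ ->; rewrite part_expoE count_row_word !nth0.
Qed.

Lemma kostka_refl nu : sorted geq nu -> kostka nu nu = 1.
Proof.
move=> nu_sorted; rewrite /kostka -size_tableau_words.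
suff /perm_size-> :
  perm_eq (tableau_words nu (part_expo nu)) [:: row_word nu] by [].
apply: uniq_perm => // [|s]; first exact: tableau_words_uniq.
rewrite mem_seq1; apply/idP/eqP => [/mem_tableau_words tab_s|->].
  have [_] := all2_leq_sumn _ _ (tableau_row_word_le _ _ _ nu_sorted tab_s).
  by rewrite (tableau_sumn _ _ _ tab_s) -/(row_weight nu) eqxx => /esym/eqP->.
exact/mem_tableau_words/is_tableau_row_word.
Qed.

Lemma count0_le s i :
  (forall j, i <= j < size s -> nth 0 s j != 0) -> count_mem 0 s <= i.
Proof.
move=> s_n0; rewrite -(cat_take_drop i s) count_cat.
have -> : count_mem 0 (drop i s) = 0.
  apply/count_memPn/(nthP 0) => -[j]; rewrite size_drop nth_drop => lt_j eq0.
  suff: nth 0 s (i + j) != 0 by rewrite eq0.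
  by apply: s_n0; rewrite leq_addr -ltn_subRL.
rewrite addn0; apply: leq_trans (count_size _ _) _; by rewrite size_take_min geq_minl.
Qed.

(** The first row is weakly increasing and contains every 0, so the 0s form an
    initial segment of the word. *)
Lemma tableau_head0 x lam y mu t i :
    sorted geq (x :: lam) -> is_tableau (x :: lam) (part_expo (y :: mu)) t ->
  i < y -> nth 0 t i = 0.
Proof.
move=> nu_sorted tab_t lt_iy; have [sz_t row_t _ cnt_t] := tab_t.
apply/eqP; apply/negPn/negP => t_i.
have := cnt_t 0; rewrite part_expoE /= => cnt0.
suff: count_mem 0 t <= i by rewrite cnt0; lia.
apply: count0_le => j /andP[le_ij]; rewrite sz_t => lt_j.
apply: contra t_i => /eqP t_j.
have := tableau_row_le _ _ _ _ nu_sorted tab_t lt_j.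
rewrite t_j leqn0 cell_row0 => lt_jx.
have lt_ix : i < x by lia.
suff: nth 0 t i <= nth 0 t j by rewrite t_j leqn0.
apply: row_t => //; first lia.
  by rewrite !cell_row_cons lt_ix lt_jx.
by rewrite !cell_col_cons lt_ix lt_jx.
Qed.

Lemma cell_row_grow x lam i : cell_row (x.+1 :: lam) i.+1 = cell_row (x :: lam) i.
Proof. by rewrite !cell_row_cons ltnS subSS. Qed.

Lemma cell_col_grow x lam i :
  cell_col (x.+1 :: lam) i.+1 = cell_col (x :: lam) i + (cell_row (x :: lam) i == 0).
Proof. by rewrite !cell_col_cons cell_row0 ltnS subSS; case: ltnP; lia. Qed.

(** Pushing a 0 into the first row moves that row one step to the right, and
    columns stay strict because the first row is weakly increasing. *)
Lemma tableau_grow x lam y mu s : sorted geq (x :: lam) ->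
    is_tableau (x :: lam) (part_expo (y :: mu)) s ->
  is_tableau (x.+1 :: lam) (part_expo (y.+1 :: mu)) (0 :: s).
Proof.
move=> nu_sorted tab_s; have [sz_s row_s col_s cnt_s] := tab_s.
split=> /=.
- by rewrite sz_s.
- case=> [|i] [|j] //= lt_i lt_j.
    rewrite cell_row_grow cell_col_grow (cell_row_cons _ _ 0) (cell_col_cons _ _ 0).
    by move=> /= ->; rewrite addn1.
  rewrite !cell_row_grow !cell_col_grow.
  by move=> eq_r le_c; apply: row_s => //; move: le_c; rewrite eq_r; lia.
- case=> [|i] [|j] //= lt_i lt_j.
  + rewrite cell_row_grow (cell_row_cons _ _ 0) /= => _ lt_r.
    exact: leq_trans lt_r (tableau_row_le _ _ _ _ nu_sorted tab_s lt_j).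
  rewrite !cell_row_grow !cell_col_grow => eq_c lt_r.
  have {}eq_c : cell_col (x :: lam) j =
      cell_col (x :: lam) i + (cell_row (x :: lam) i == 0).
    by rewrite eq_c; case: (cell_row _ j) lt_r => //=; rewrite addn0.
  (* [k] is the cell above [j] in the row of [i]: it is [i] or, in the first
     row, the right neighbour of [i]. *)
  have [k [lt_k row_k col_k]] :=
    cell_above _ j (cell_row (x :: lam) i) nu_sorted lt_j (ltnW lt_r).
  apply: leq_ltn_trans (col_s k j lt_k lt_j col_k _); last by rewrite row_k.
  by apply: row_s => //; rewrite col_k eq_c leq_addr.
- case=> [|k]; have := cnt_s 0; last have := cnt_s k.+1; rewrite !part_expoE /=; lia.
Qed.

(** Conversely, removing the first cell of the first row moves that row one
    step to the left.  Columns stay strict if the 0s that remain still cover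
    the whole second row, which is what [head 0 lam <= y] ensures. *)
Lemma tableau_shrink x lam y mu t : sorted geq (x :: lam) -> head 0 lam <= y ->
    is_tableau (x.+1 :: lam) (part_expo (y.+1 :: mu)) t ->
  exists2 s, is_tableau (x :: lam) (part_expo (y :: mu)) s & t = 0 :: s.
Proof.
move=> nu_sorted le_lam_y tab_t; have [sz_t row_t col_t cnt_t] := tab_t.
have nu1_sorted : sorted geq (x.+1 :: lam).
  move: nu_sorted {le_lam_y row_t col_t sz_t tab_t}.
  by case: lam => //= l lam /andP[/leqW-> ->].
have t0 := tableau_head0 _ _ _ _ _ _ nu1_sorted tab_t.
case: t => [//|t0' s] in sz_t row_t col_t cnt_t tab_t t0 *.
have /= eq_t0' := t0 0 isT; subst t0'.
have lt_succ i : i < sumn (x :: lam) -> i.+1 < sumn (x.+1 :: lam) by [].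
exists s => //; split.
- by case: sz_t.
- move=> i j /lt_succ lt_i /lt_succ lt_j eq_r le_c; apply: (row_t i.+1 j.+1) => //.
  by rewrite !cell_col_grow eq_r leq_add2r.
- move=> i j /lt_succ lt_i1 lt_j eq_c lt_r; have lt_j1 := lt_succ j lt_j.
  have [row_i|row_i] := posnP (cell_row (x :: lam) i); last first.
    apply: (col_t i.+1 j.+1) => //; rewrite ?cell_row_grow //.
    rewrite !cell_col_grow eq_c.
    by case: (cell_row _ i) row_i lt_r => //; case: (cell_row _ j).
  have lt_ix : i < x by rewrite -(cell_row0 x lam) row_i.
  have le_row : cell_row (x :: lam) j <= nth 0 s j.
    have := tableau_row_le _ _ _ j.+1 nu1_sorted tab_t lt_j1.
    by rewrite cell_row_grow.
  suff -> : nth 0 s i = 0 by apply: leq_trans le_row; rewrite -row_i.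
  apply: (t0 i.+1); rewrite ltnS.
  (* The cell above [j] in the second row bounds the column of [j]. *)
  have [k [lt_k row_k col_k]] :=
    cell_above _ j 1 nu_sorted lt_j (leq_ltn_trans (leq0n _) lt_r).
  have := cell_col_lt _ _ lt_k; rewrite row_k col_k -eq_c cell_col_cons lt_ix /=.
  by rewrite nth0 => /leq_trans; apply.
- by case=> [|k]; [have := cnt_t 0 | have := cnt_t k.+1]; rewrite !part_expoE /=; lia.
Qed.

Lemma kostka_grow x lam y mu : sorted geq (x :: lam) -> head 0 lam <= y ->
  kostka (x.+1 :: lam) (y.+1 :: mu) = kostka (x :: lam) (y :: mu).
Proof.
move=> nu_sorted le_lam_y; rewrite /kostka -!size_tableau_words.
rewrite -[RHS](size_map (cons 0)); apply: perm_size; apply: uniq_perm.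
- exact: tableau_words_uniq.
- by rewrite map_inj_uniq ?tableau_words_uniq // => s t [].
move=> t; apply/idP/mapP => [/mem_tableau_words|[s /mem_tableau_words tab_s ->]].
  case/(tableau_shrink _ _ _ _ _ nu_sorted le_lam_y) => s tab_s ->.
  by exists s => //; apply/mem_tableau_words.
exact/mem_tableau_words/tableau_grow.
Qed.

(** Moving [e] cells from the first row to the second gives the content of an
    explicit tableau: the superstandard one, with the last [e] entries of its
    first row raised from 0 to 1.  The raised entries lie beyond the second
    row because [l <= b]. *)
Lemma kostka_transfer_gt0 b e l lam : sorted geq (l :: lam) -> l <= b ->
  0 < kostka (b + e :: l :: lam) (b :: l + e :: lam).
Proof.
move=> lam_sorted le_lb; apply/kostka_gt0P; set nu := b + e :: l :: lam.
have nu_sorted : sorted geq nu by apply/andP; split=> //=; lia.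
pose s := nseq b 0 ++ nseq e 1 ++ [seq r.+1 | r <- row_word (l :: lam)].
have nth_s i : i < sumn nu -> nth 0 s i = cell_row nu i + (b <= i < b + e).
  move=> lt_i; rewrite cell_row_cons nth_cat size_nseq nth_nseq.
  case: (ltnP i b) => [lt_ib|le_bi]; first by rewrite ltn_addr.
  rewrite nth_cat size_nseq nth_nseq /= ltn_subLR //.
  case: ltnP => // le_be.
  rewrite addn0 (nth_map 0); last by rewrite size_row_word; move: lt_i; rewrite /nu /=; lia.
  rewrite subnDA nth_row_word //; move: lt_i; rewrite /nu /=; lia.
exists s; split.
- by rewrite !size_cat !size_nseq size_map size_row_word /nu /=; lia.
- move=> i j lt_i lt_j eq_r; rewrite !nth_s // eq_r leq_add2l.
  move: eq_r; rewrite !cell_row_cons !cell_col_cons.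
  by case: (ltnP i (b + e)); case: (ltnP j (b + e)) => //; rewrite ?andbT ?andbF //; lia.
- move=> i j lt_i lt_j eq_c lt_r; rewrite !nth_s //.
  suff -> : b <= i < b + e = false by rewrite addn0 ltn_addr.
  apply/negbTE/negP => /andP[le_bi lt_ibe].
  (* The cell above [j] in the second row bounds the column of [j]. *)
  have [k [lt_k row_k col_k]] :=
    cell_above _ j 1 nu_sorted lt_j (leq_ltn_trans (leq0n _) lt_r).
  have := cell_col_lt _ _ lt_k; rewrite row_k col_k -eq_c cell_col_cons lt_ibe /=.
  lia.
- move=> k; rewrite part_expoE !count_cat !count_nseq count_map_succ.
  by case: k => [|[|k]]; rewrite ?count_row_word /=; lia.
Qed.

End Kostka.

(** * Kostka numbers of padded partitions *)

Section Padding.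
Local Open Scope nat_scope.
Implicit Types (nu mu lam : seq nat).

Lemma padE lam n : is_part lam -> sumn lam < n -> pad lam n = n - sumn lam :: lam.
Proof.
move=> /andP[_ lam_pos] lt_n; rewrite /pad /= subn_gt0 lt_n; congr (_ :: _).
apply/all_filterP/allP=> i i_lam; rewrite lt0n; apply: contra lam_pos.
by move=> /eqP <-.
Qed.

(** The degenerate case, in which [pad] drops a first part equal to 0. *)
Lemma pad_def_case lam n : is_part lam -> pad_def lam n ->
  sumn lam < n \/ lam = [::] /\ n = 0.
Proof.
rewrite /pad_def => /andP[_ lam_pos] le_n.
case: (ltnP (sumn lam) n) => [|le_lam]; [by left | right].
case: lam lam_pos le_n le_lam => [|x lam] /=; first by split=> //; lia.
by rewrite inE negb_or => /andP[/eqP x_neq0 _] le_n le_lam; exfalso; lia.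
Qed.

Lemma pad_is_part lam n : is_part lam -> pad_def lam n -> is_part (pad lam n).
Proof.
move=> lam_part def_n; have [lt_n|[-> ->]//] := pad_def_case _ _ lam_part def_n.
rewrite padE //; case/andP: lam_part => lam_sorted lam_pos.
rewrite /is_part inE negb_or lam_pos andbT; apply/andP; split; last by lia.
by move: lam_sorted def_n; rewrite /pad_def; case: (lam) => //= x s -> ?; lia.
Qed.

Lemma sumn_pad lam n : is_part lam -> pad_def lam n -> sumn (pad lam n) = n.
Proof.
move=> lam_part def_n; have [lt_n|[-> ->]//] := pad_def_case _ _ lam_part def_n.
by rewrite padE //= subnK // ltnW.
Qed.

Lemma head_pad lam n : is_part lam -> pad_def lam n ->
  head 0 (pad lam n) = n - sumn lam.
Proof.
move=> lam_part def_n; have [lt_n|[-> ->]//] := pad_def_case _ _ lam_part def_n.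
by rewrite padE.
Qed.

Lemma behead_pad lam n : is_part lam -> pad_def lam n -> behead (pad lam n) = lam.
Proof.
move=> lam_part def_n; have [lt_n|[-> ->]//] := pad_def_case _ _ lam_part def_n.
by rewrite padE.
Qed.

Lemma pad_behead nu : is_part nu ->
  [/\ is_part (behead nu), pad_def (behead nu) (sumn nu)
    & pad (behead nu) (sumn nu) = nu].
Proof.
case: nu => [|x lam] // nu_part.
have lam_part : is_part lam.
  move: nu_part; rewrite /is_part inE negb_or => /andP[/path_sorted -> /andP[_ ->]] //.
have x_gt0 : 0 < x.
  by move: nu_part; rewrite /is_part inE negb_or => /andP[_ /andP[]]; lia.
split=> //=; last by rewrite padE ?addnK //; lia.
rewrite /pad_def addnC leq_add2r; case: lam nu_part {lam_part} => //= y lam.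
by case/andP => /andP[].
Qed.

(** [row_weight (pad lam n)] is independent of [n], as row number 0 contributes
    nothing to it; any length of the first row gives the same value. *)
Definition padded_weight lam := row_weight (0 :: lam).

Lemma row_weight_pad lam n : is_part lam -> pad_def lam n ->
  row_weight (pad lam n) = padded_weight lam.
Proof.
move=> lam_part def_n; have [lt_n|[-> ->]//] := pad_def_case _ _ lam_part def_n.
by rewrite padE // /padded_weight !row_weight_cons.
Qed.

Lemma is_part_sorted lam : is_part lam -> sorted geq lam.
Proof. by case/andP. Qed.

Lemma kostka_pad_gt0 lam mu n :
    is_part lam -> is_part mu -> pad_def lam n -> pad_def mu n ->
    0 < kostka (pad lam n) (pad mu n) ->
  lam = mu \/ padded_weight lam < padded_weight mu.
Proof.
move=> lam_part mu_part def_lam def_mu K_gt0.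
have := kostka_weight _ _ (pad_is_part _ _ lam_part def_lam)
  (pad_is_part _ _ mu_part def_mu) K_gt0.
rewrite !row_weight_pad // => -[eq_pad|]; [left | by right].
by rewrite -(behead_pad _ _ lam_part def_lam) eq_pad behead_pad.
Qed.

Lemma kostka_behead_sumn nu mu n : is_part nu -> sumn nu = n ->
    is_part mu -> pad_def mu n -> 0 < kostka nu (pad mu n) ->
  sumn (behead nu) <= sumn mu.
Proof.
move=> nu_part sum_nu mu_part def_mu.
move=> /(kostka_head _ _ (is_part_sorted _ nu_part)); rewrite head_pad //.
move: sum_nu def_mu; rewrite /pad_def; case: (nu) => //= x s; lia.
Qed.

(** From [|mu| + lambda_1] on, the 0s in the first row cover the second row, and
    [kostka_grow] applies at every step. *)
Lemma kostka_pad_stable lam mu n n' : is_part lam -> is_part mu ->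
    pad_def lam n -> pad_def mu n -> sumn mu + head 0 lam <= n -> n <= n' ->
  kostka (pad lam n') (pad mu n') = kostka (pad lam n) (pad mu n).
Proof.
move=> lam_part mu_part def_lam def_mu le_n.
elim: n' => [|n' IHn']; first by rewrite leqn0 => /eqP->.
rewrite leq_eqVlt => /orP[/eqP-> //|]; rewrite ltnS => le_nn'.
rewrite -{}IHn' //.
have lam_def k : n <= k -> pad_def lam k by apply: leq_trans.
have mu_def k : n <= k -> pad_def mu k by apply: leq_trans.
have [lt_lam|[lam0 n'0]] := pad_def_case _ _ lam_part (lam_def n' le_nn'); last first.
  have /eqP mu0 : mu == [::].
    have [|[-> _] //] := pad_def_case _ _ mu_part (mu_def n' le_nn'); lia.
  by rewrite lam0 mu0 !kostka_refl // is_part_sorted // pad_is_part.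
have [lt_mu|[mu0 n'0]] := pad_def_case _ _ mu_part (mu_def n' le_nn'); last by lia.
rewrite !padE ?leqW // ?(leqW lt_lam) ?(leqW lt_mu) //.
rewrite !subSn ?(ltnW lt_lam) ?(ltnW lt_mu) // kostka_grow //; last by lia.
have := is_part_sorted _ (pad_is_part _ _ lam_part (lam_def n' le_nn')).
by rewrite padE.
Qed.

(** The witness is [lam] with its first part enlarged to reach size [m].  It
    detects [lam] at every [n] where it can be padded, and the least such [n]
    is at least [m + lambda_1], where all Kostka numbers of [lam] with contents
    of size at most [m] have become constant. *)
Lemma kostka_pad_spread lam m : is_part lam -> lam != [::] -> sumn lam <= m ->
  exists mu, [/\ is_part mu, sumn mu = m, m + head 0 lam <= sumn mu + head 0 mu
    & forall n, pad_def mu n -> 0 < kostka (pad lam n) (pad mu n)].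
Proof.
case: lam => // l lam lam_part _ le_m; set e := m - sumn (l :: lam).
have [lam_sorted lam_pos] := andP lam_part.
have l_gt0 : 0 < l by move: lam_pos; rewrite inE negb_or; lia.
have mu_part : is_part (l + e :: lam).
  apply/andP; split.
    by move: lam_sorted; case: (lam) => //= x s /andP[le_xl ->]; rewrite andbT; lia.
  by move: lam_pos; rewrite !inE !negb_or => /andP[_ ->]; rewrite andbT; lia.
have sum_mu : sumn (l + e :: lam) = m by rewrite /e /= in le_m *; lia.
exists (l + e :: lam); split=> //; first by rewrite sum_mu leq_add2l leq_addr.
move=> n; rewrite /pad_def sum_mu /= => le_n.
rewrite !padE ?sum_mu //; [|by lia..].
have -> : n - sumn (l :: lam) = n - m + e by rewrite /e; lia.
by apply: kostka_transfer_gt0 => //; lia.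
Qed.

End Padding.

(** * From monomial coefficients to multiplicities *)

Section Inversion.
Local Open Scope nat_scope.
Implicit Types (nu mu lam : seq nat).

(** [M n nu] stands for the multiplicity of the Specht module of [nu] in degree
    [n]. *)
Variable M : nat -> seq nat -> nat.

Definition padded_mult lam n := if pad_def lam n then M n (pad lam n) else 0.

Definition monomial_mult mu n :=
  if pad_def mu n then \sum_(nu <- parts n) M n nu * kostka nu (pad mu n) else 0.

Definition parts_upto m := undup (flatten [seq parts k | k <- iota 0 m.+1]).

Lemma mem_parts_upto m lam :
  (lam \in parts_upto m) = is_part lam && (sumn lam <= m).
Proof.
rewrite mem_undup; apply/flatten_mapP/andP => [[k]|[lam_part le_m]].
  rewrite mem_iota add0n ltnS => le_km.
  by rewrite mem_parts => /andP[-> /eqP->].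
by exists (sumn lam); rewrite ?mem_iota ?mem_parts ?lam_part ?eqxx.
Qed.

(** Reindexing by padded partitions makes the range of summation independent of
    [n]; the shapes left out have more than [m] cells below the first row, and
    their Kostka numbers are 0. *)
Lemma monomial_multE m mu n : is_part mu -> sumn mu <= m -> pad_def mu n ->
  monomial_mult mu n =
    \sum_(lam <- parts_upto m) padded_mult lam n * kostka (pad lam n) (pad mu n).
Proof.
move=> mu_part le_m def_mu; rewrite /monomial_mult def_mu.
pose F nu := M n nu * kostka nu (pad mu n); pose P nu := 0 < kostka nu (pad mu n).
have drop0 (r : seq (seq nat)) :
    \sum_(nu <- r) F nu = \sum_(nu <- [seq nu <- r | P nu]) F nu.
  rewrite big_filter [LHS](bigID P) /= [X in _ + X]big1 ?addn0 // => nu.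
  by rewrite /P -eqn0Ngt /F => /eqP->; rewrite muln0.
rewrite [LHS]drop0.
transitivity
  (\sum_(nu <- [seq pad lam n | lam <- parts_upto m & pad_def lam n]) F nu).
  rewrite [RHS]drop0; apply: perm_big; apply: uniq_perm.
  - by rewrite filter_uniq // parts_uniq.
  - rewrite filter_uniq // map_inj_in_uniq ?filter_uniq ?undup_uniq // => lam1 lam2.
    rewrite !mem_filter !mem_parts_upto => /and3P[def1 part1 _] /and3P[def2 part2 _].
    by move=> eq_pad; rewrite -(behead_pad _ _ part1 def1) eq_pad behead_pad.
  move=> nu; rewrite !(mem_filter P); apply: andb_id2l => P_nu.
  rewrite mem_parts; apply/andP/mapP => [[nu_part /eqP sum_nu]|[lam]].
    have [lam_part] := pad_behead _ nu_part; rewrite sum_nu => def_lam pad_lam.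
    exists (behead nu) => //; rewrite mem_filter def_lam mem_parts_upto lam_part /=.
    by apply: leq_trans le_m; apply: (kostka_behead_sumn _ _ n).
  rewrite mem_filter mem_parts_upto => /and3P[def_lam lam_part _] ->.
  by rewrite pad_is_part // sumn_pad.
rewrite big_map big_filter big_mkcond; apply: eq_bigr => lam _.
by rewrite /padded_mult; case: ifP.
Qed.

Lemma padded_mult_le mu n : is_part mu -> padded_mult mu n <= monomial_mult mu n.
Proof.
move=> mu_part; have [def_mu|ndef] := boolP (pad_def mu n); last first.
  by rewrite /padded_mult (negPf ndef).
rewrite (monomial_multE (sumn mu)) // (bigD1_seq mu) ?undup_uniq //=; last first.
  by rewrite mem_parts_upto mu_part /=.
by rewrite kostka_refl ?muln1 ?leq_addr // is_part_sorted // pad_is_part.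
Qed.

Variables (m n0 : nat).
Hypothesis coef_stable : forall mu, is_part mu -> sumn mu <= m ->
  forall n, n0 <= n -> monomial_mult mu n = monomial_mult mu n0.

(** Positivity at work: a multiplicity that is nonzero for all large [n] forces
    the coefficient at the partition [mu] of [kostka_pad_spread] to be nonzero
    for large [n], hence already at [n0], where [mu[n0]] must then be
    defined. *)
Lemma persistent_bound lam : is_part lam -> lam != [::] -> sumn lam <= m ->
    (forall n, n0 <= n -> padded_mult lam n != 0) ->
  m + head 0 lam <= n0.
Proof.
move=> lam_part lam_n0 le_m c_n0.
have [mu [mu_part sum_mu bound K_gt0]] :=
  kostka_pad_spread _ _ lam_part lam_n0 le_m.
rewrite leqNgt; apply/negP => /leq_trans/(_ bound) lt_n0.
have D_n0 : monomial_mult mu n0 = 0.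
  by rewrite /monomial_mult ifN // /pad_def -ltnNge.
pose n := n0 + (sumn mu + head 0 mu).
have def_mu : pad_def mu n by rewrite /pad_def leq_addl.
have := coef_stable mu mu_part _ n (leq_addr _ _); rewrite D_n0 sum_mu => /(_ (leqnn m)).
rewrite (monomial_multE m) ?sum_mu // => /eqP; rewrite sum_nat_seq_eq0.
move=> /allP/(_ lam); rewrite mem_parts_upto lam_part le_m => /(_ isT) /=.
by rewrite muln_eq0 (negPf (c_n0 n (leq_addr _ _))) /= -leqn0 leqNgt K_gt0.
Qed.

(** Triangular inversion.  In the expansion of the coefficient at [lam], each
    other term is constant from [n0] on: its multiplicity is, by induction,
    and its Kostka number is as well, by [persistent_bound], unless the
    multiplicity is 0.  What remains is the multiplicity of [lam], with
    Kostka number 1. *)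
Lemma padded_mult_stable lam : is_part lam -> sumn lam <= m ->
  forall n, n0 <= n -> padded_mult lam n = padded_mult lam n0.
Proof.
have [w] := ubnP (padded_weight lam).
elim: w lam => // w IHw lam; rewrite ltnS => le_w lam_part le_m n le_n.
have D_lam := coef_stable lam lam_part le_m n le_n.
have [def0|ndef0] := boolP (pad_def lam n0); last first.
  have c_n0 : padded_mult lam n0 = 0 by rewrite /padded_mult (negPf ndef0).
  have D_n0 : monomial_mult lam n0 = 0 by rewrite /monomial_mult (negPf ndef0).
  by apply/eqP; rewrite c_n0 -leqn0 -D_n0 -D_lam padded_mult_le.
have def_n : pad_def lam n by apply: leq_trans le_n.
have K1 k : pad_def lam k -> kostka (pad lam k) (pad lam k) = 1.
  by move=> def_k; rewrite kostka_refl // is_part_sorted // pad_is_part.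
have lam_m : lam \in parts_upto m by rewrite mem_parts_upto lam_part.
move: D_lam; rewrite !(monomial_multE m) // !(bigD1_seq lam lam_m) ?undup_uniq //=.
rewrite !K1 // !muln1.
suff -> : \sum_(nu <- parts_upto m | nu != lam)
             padded_mult nu n * kostka (pad nu n) (pad lam n) =
          \sum_(nu <- parts_upto m | nu != lam)
             padded_mult nu n0 * kostka (pad nu n0) (pad lam n0) by move/addIn.
rewrite big_seq_cond [RHS]big_seq_cond; apply: eq_bigr => nu.
rewrite mem_parts_upto -andbA => /and3P[nu_part nu_m nu_lam].
have [w_lt|w_ge] := ltnP (padded_weight nu) (padded_weight lam); last first.
  have vanish k : pad_def lam k ->
      padded_mult nu k * kostka (pad nu k) (pad lam k) = 0.
    move=> def_k; apply/eqP; rewrite muln_eq0 /padded_mult.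
    case: ifP => //= def_nu; apply/orP; right; rewrite -leqn0 leqNgt.
    apply/negP=> /(kostka_pad_gt0 _ _ _ nu_part lam_part def_nu def_k) [eq_nu|].
      by rewrite eq_nu eqxx in nu_lam.
    by rewrite ltnNge w_ge.
  by rewrite !vanish.
have c_nu := IHw nu (leq_trans w_lt le_w) nu_part nu_m.
rewrite (c_nu n le_n).
have [-> //|c_neq0] := eqVneq (padded_mult nu n0) 0.
congr (_ * _); apply: kostka_pad_stable => //.
  by move: c_neq0; rewrite /padded_mult; case: ifP.
have [nu0|nu_n0] := eqVneq nu [::].
  by rewrite nu0 addn0; apply: leq_trans def0; apply: leq_addr.
apply: leq_trans (persistent_bound nu nu_part nu_n0 nu_m _).
  by rewrite leq_add2r.
by move=> k le_k; rewrite c_nu.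
Qed.

End Inversion.

(** * Stable ranges *)

Section StableRanges.
Variable (R : realType).

Lemma rgm_fin (K : nzRingType) (F : nat -> Defs.series K) mu :
    (rgm R F mu < +oo :> \bar R)%E ->
  exists2 N, rgm R F mu = N%:R%:E :> \bar R
    & forall n, (N <= n)%N -> dcoef F mu n = dcoef F mu N.
Proof.
move=> fin_mu; pose P n := `[< forall k, dcoef F mu n = dcoef F mu (n + k)%N >].
have exP : exists n, P n.
  apply: contrapT => noP; move: fin_mu; rewrite /rgm.
  rewrite (_ : mkset _ = set0) ?image_set0 ?ereal_inf0 ?ltxx //.
  by apply/seteqP; split=> // n /asboolP Pn; apply: noP; exists n.
case: (ex_minnP exP) => N /asboolP PN minN; exists N; last first.
  by move=> n le_n; rewrite (PN (n - N)%N) subnKC.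
apply/eqP; rewrite eq_le; apply/andP; split.
  by apply: ereal_inf_lbound; exists N.
apply/ereal_infP => _ [n Pn <-]; rewrite lee_fin ler_nat.
exact/minN/asboolP.
Qed.

Lemma rgm_max_ge (K : nzRingType) (F : nat -> Defs.series K) (b : \bar R) mu :
  is_part mu -> ((sumn mu)%:R%:E <= b)%E -> (rgm R F mu <= rgm_max F b)%E.
Proof. by move=> mu_part le_b; apply: ereal_sup_ubound; exists mu. Qed.

(** There are finitely many partitions of size at most [b], so the supremum is
    that of a finite nonempty set of natural numbers, and it is attained. *)
Lemma rgm_max_fin (K : nzRingType) (F : nat -> Defs.series K) (b : \bar R) :
  m_stable R F -> (0 <= b)%E -> (b < +oo)%E ->
  exists N, rgm_max F b = N%:R%:E.
Proof.
move=> F_stable b_ge0 b_fin.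
have [m le_m] : exists m, (b <= m%:R%:E)%E.
  case: b b_ge0 b_fin => // r; rewrite lee_fin => r_ge0 _.
  by exists (Num.bound r); rewrite lee_fin; apply/ltW/archi_boundP.
pose P k := `[< exists2 mu, is_part mu /\ ((sumn mu)%:R%:E <= b)%E
                          & rgm R F mu = k%:R%:E :> \bar R >].
have exP : exists k, P k.
  have [N rg_N _] := rgm_fin K F [::] (F_stable [::] isT).
  by exists N; apply/asboolP; exists [::].
have [B le_B] : exists B, forall mu, mu \in parts_upto m ->
    (rgm R F mu <= B%:R%:E :> \bar R)%E.
  have: {subset parts_upto m <= is_part}.
    by move=> mu; rewrite mem_parts_upto => /andP[].
  elim: (parts_upto m) => [|mu r IHr] r_part; first by exists 0.
  have [|B le_B] := IHr; first by move=> nu nu_r; rewrite r_part // inE nu_r orbT.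
  have [|N rg_N _] := rgm_fin K F mu; first by apply/F_stable/r_part/mem_head.
  exists (maxn B N) => nu; rewrite inE => /predU1P[->|/le_B le_nu].
    by rewrite rg_N lee_fin ler_nat leq_maxr.
  by apply: le_trans le_nu _; rewrite lee_fin ler_nat leq_maxl.
have ubP k : P k -> (k <= B)%N.
  case/asboolP=> mu [mu_part le_b] rg_mu; rewrite -(ler_nat R) -lee_fin -rg_mu.
  apply: le_B; rewrite mem_parts_upto mu_part /=.
  by rewrite -(ler_nat R) -lee_fin (le_trans le_b).
case: (ex_maxnP exP ubP) => N /asboolP[mu [mu_part le_b] rg_mu] maxN; exists N.
apply/eqP; rewrite eq_le; apply/andP; split; last by rewrite -rg_mu rgm_max_ge.
apply: ge_ereal_sup => _ [nu [nu_part nu_b] <-].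
have [N' rg_nu _] := rgm_fin K F nu (F_stable nu nu_part).
rewrite rg_nu lee_fin ler_nat; apply: maxN.
by apply/asboolP; exists nu.
Qed.

Variable V : forall n : nat, representation R[i] [set: 'S_n]%G.

Lemma dcoef_frobenius mu n :
  dcoef (frobenius_seq V) mu n =
    (monomial_mult (fun k => mult (V k)) mu n)%:R.
Proof.
rewrite /dcoef /monomial_mult; case: ifP => // _.
rewrite /mcoef /frobenius_seq /frobenius natr_sum; apply: eq_bigr => nu _.
by rewrite natrM.
Qed.

(** The equality of complex coefficients descends to natural numbers because
    the complex numbers have characteristic 0. *)
Lemma cmult_stable lam n0 : is_part lam -> m_stable R (frobenius_seq V) ->
    (forall mu, is_part mu -> (sumn mu <= sumn lam)%N ->
       (rgm R (frobenius_seq V) mu <= n0%:R%:E :> \bar R)%E) ->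
  forall n, (n0 <= n)%N -> cmult V lam n = cmult V lam n0.
Proof.
move=> lam_part F_stable rg_le.
apply: (padded_mult_stable (fun k => mult (V k)) (sumn lam)) => //.
move=> mu mu_part le_mu n le_n.
have [N rg_N D_N] := rgm_fin _ _ mu (F_stable mu mu_part).
have := rg_le mu mu_part le_mu; rewrite rg_N lee_fin ler_nat => le_N.
apply/eqP; rewrite -(eqr_nat R[i]) -!dcoef_frobenius.
by rewrite !D_N // (leq_trans le_N).
Qed.

Lemma wt_ge0 : (0 <= wt V)%E.
Proof. by apply: ereal_sup_ubound; left. Qed.

Lemma cmult_wt lam n : is_part lam -> ~~ ((sumn lam)%:R%:E <= wt V)%E ->
  cmult V lam n = 0%N.
Proof.
move=> lam_part; apply: contraNeq => c_neq0; apply: ereal_sup_ubound; right.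
exists lam => //; split=> //; exists n; split; last exact/eqP.
by move: c_neq0; rewrite /cmult; case: ifP.
Qed.

End StableRanges.

Theorem proposition6p0p1 (R : realType)
    (V : forall n : nat, representation R[i] [set: 'S_n]%G) :
  (wt V < +oo)%E ->
  m_stable R (frobenius_seq V) ->
  [/\ URMS V,
      (forall lam : seq nat, is_part lam ->
         forall n n' : nat,
           (rgm_max (frobenius_seq V) (sumn lam)%:R%:E <= n%:R%:E :> \bar R)%E ->
           (rgm_max (frobenius_seq V) (sumn lam)%:R%:E <= n'%:R%:E :> \bar R)%E ->
           cmult V lam n = cmult V lam n')
    & (exists N : nat,
         rgm_max (frobenius_seq V) (wt V) = N%:R%:E /\ URMS_range V N)].
Proof.
move=> wt_fin F_stable.
have [N rg_N] := rgm_max_fin R _ _ _ F_stable (wt_ge0 R V) wt_fin.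
have range_N : URMS_range V N.
  move=> n lam le_n lam_part.
  have [le_wt|gt_wt] := boolP ((sumn lam)%:R%:E <= wt V)%E; last first.
    by rewrite !cmult_wt.
  have c_N : forall k, (N <= k)%N -> cmult V lam k = cmult V lam N.
    apply: cmult_stable => // mu mu_part le_mu; rewrite -rg_N rgm_max_ge //.
    by apply: le_trans le_wt; rewrite lee_fin ler_nat.
  by rewrite !c_N // leqW.
split; [by exists N | | by exists N].
move=> lam lam_part.
have half n n' : (n <= n')%N ->
    (rgm_max (frobenius_seq V) (sumn lam)%:R%:E <= n%:R%:E :> \bar R)%E ->
    cmult V lam n = cmult V lam n'.
  move=> le_nn' le_rg; apply/esym/cmult_stable => // mu mu_part le_mu.
  apply: le_trans le_rg; rewrite rgm_max_ge // lee_fin ler_nat //.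
move=> n n' rg_n rg_n'; have [le_nn'|lt_n'n] := leqP n n'; first exact: half.
exact/esym/half/rg_n'/ltnW.
Qed.
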